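(* Let $n\ge 2$. (1) For any $N\in M^2_{BC_n}(\mathbb C)$, the symplectic thin Schubert cell $\mathrm{SpG}_N=\{x\in\mathrm{SpG}(2,2n): M(x)=N\}$ can be written as $$\mathrm{SpG}_N=\bigsqcup_M (G_M\cap\mathcal H)$$ for some $S_{2n}$-matroids $M$ (of rank $2$ on $[2n]$). Moreover there is a decomposition $$\mathrm{SpG}(2,2n)=\bigsqcup_{N\in M^2_{BC_n}(\mathbb C)}\mathrm{SpG}_N$$ into a disjoint union of locally closed sets. (2) For any $N\in M^2_{BC_n}(\mathbb C)$, there exists precisely one $M$ among the matroids appearing in the decomposition of $\mathrm{SpG}_N$ in (1) that satisfies $$\overline{\mathrm{SpG}_N}=\overline{G_M\cap\mathcal H}.$$ In particular $\mathrm{SpG}_N$ is irreducible.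
   Context: Work over $\mathbb C$. Let $E_n=[n]\cup[n^*]$, identified with $[2n]$ via $i^*=2n+1-i$ ($i^{**}=i$), and let $J_n^2=\{\{i,j\}\in\binom{E_n}{2}: j\neq i^*\}$ be the set of admissible pairs. $G(2,2n)\subset\mathbb P^N$ is the Grassmannian of $2$-planes in $\mathbb C^{2n}$ with Plücker coordinates $[x_{i,j}]$, $\mathcal H=\{\sum_{i=1}^n x_{i,i^*}=0\}$, and $\mathrm{SpG}(2,2n)=G(2,2n)\cap\mathcal H$ is the symplectic Grassmannian of isotropic $2$-planes. An $S_{2n}$-matroid is an ordinary matroid; for a rank $2$ matroid $M$ on $[2n]$ with set of bases $B(M)$, the thin Schubert cell is $G_M=\{x\in G(2,2n):\{\{i,j\}:x_{i,j}\neq0\}=B(M)\}$. For $x\in\mathrm{SpG}(2,2n)$, let $\mathcal B(x)=\{\{i,j\}\in J_n^2: x_{i,j}\ne0\}$ and let $M(x)=(E_n,*,\mathcal B(x))$, the $BC_n$-matroid (symplectic matroid of rank $2$) of $x$. $M^2_{BC_n}(\mathbb C)$ is the set of $\mathbb C$-representable $BC_n$-matroids of rank $2$ on $E_n$, i.e. those of the form $M(x)$ for some $x\in\mathrm{SpG}(2,2n)$. *)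

(* Defs.v *)
From HB Require Import structures.
From mathcomp Require Import all_boot all_order all_fingroup all_algebra.
From mathcomp Require Import boolp classical_sets reals topology complex.
From mathcomp Require Import mpoly.

Set Implicit Arguments.
Unset Strict Implicit.
Unset Printing Implicit Defensive.

Import GRing.Theory.
Local Open Scope ring_scope.
Local Open Scope classical_set_scope.

(* The projective space P(K^m), whose points are the lines of K^m; it carries
   the Zariski topology. *)
Definition projective (K : fieldType) (m : nat) :=
  {L : {vspace 'rV[K]_m} | \dim L == 1%N}.

HB.instance Definition _ (K : fieldType) (m : nat) :=
  Choice.on (projective K m).

(* Homogeneous coordinates of x: those of an arbitrarily chosen nonzero vector
   of the line x.  All uses below are invariant under rescaling. *)
Definition hcoord (K : fieldType) (m : nat) (x : projective K m) (k : 'I_m) :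
  K := vpick (val x) 0 k.

Definition homogeneous (K : fieldType) (m : nat) (f : {mpoly K[m]}) : Prop :=
  exists d, f \is d.-homog.

Definition zero_locus (K : fieldType) (m : nat) (S : set {mpoly K[m]}) :
  set (projective K m) :=
  [set x | forall f, S f -> f.@[hcoord x] = 0].

Definition zariski_open (K : fieldType) (m : nat) (U : set (projective K m)) :
  Prop :=
  exists2 S : set {mpoly K[m]},
    S `<=` @homogeneous K m & U = ~` zero_locus S.

Lemma zariski_openT (K : fieldType) (m : nat) :
  @zariski_open K m setT.
Proof.
exists [set 1].
  by move=> _ ->; exists 0%N; apply: dhomog1.
apply/seteqP; split=> // x _ /= /(_ 1 erefl)/eqP.
by rewrite meval1 oner_eq0.
Qed.

Lemma zariski_openI (K : fieldType) (m : nat) :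
  setI_closed (@zariski_open K m).
Proof.
move=> _ _ [S hS ->] [T hT ->].
exists [set h | exists f g, [/\ S f, T g & h = f * g]].
  move=> _ [f [g [/hS[d hf] /hT[e hg] ->]]].
  by exists (d + e)%N; apply: dhomogM.
rewrite -setCU; congr (~` _); apply/seteqP; split=> x /=.
  move=> [hx|hx] _ [f [g [Sf Tg ->]]]; rewrite mevalM.
    by rewrite hx ?mul0r.
  by rewrite (hx _ Tg) mulr0.
move=> hx; apply: contrapT => /not_orP[].
move=> /existsNP[f /not_implyP[Sf /eqP f0]].
move=> /existsNP[g /not_implyP[Tg /eqP g0]].
have /eqP := hx _ (ex_intro _ f (ex_intro _ g (And3 Sf Tg erefl))).
by rewrite mevalM mulf_eq0 (negPf f0) (negPf g0).
Qed.

Lemma zariski_open_bigU (K : fieldType) (m : nat) (I : Type)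
    (U : I -> set (projective K m)) :
  (forall i, zariski_open (U i)) -> zariski_open (\bigcup_i U i).
Proof.
move=> oU; exists [set f | exists i S,
    [/\ S `<=` @homogeneous K m, U i = ~` zero_locus S & S f]].
  by move=> f [i [S [hS _]]]; apply: hS.
apply/seteqP; split=> x /=.
  move=> [i _ Uix] hx; have [S hS E] := oU i.
  by move: Uix; rewrite E; apply=> f Sf; apply: hx; exists i, S.
move=> hx; apply: contrapT => nUx; apply: hx => f [i [S [_ E Sf]]].
have : ~ U i x by move=> ?; apply: nUx; exists i.
by rewrite E => /contrapT; apply.
Qed.

HB.instance Definition _ (K : fieldType) (m : nat) :=
  @isOpenTopological.Build (projective K m) (@zariski_open K m)
    (@zariski_openT K m) (@zariski_openI K m) (@zariski_open_bigU K m).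

Definition locally_closed (T : topologicalType) (A : set T) : Prop :=
  exists U F : set T, [/\ open U, closed F & A = U `&` F].

Definition irreducible (T : topologicalType) (A : set T) : Prop :=
  A !=set0 /\
  forall F1 F2 : set T, closed F1 -> closed F2 ->
    A `<=` F1 `|` F2 -> A `<=` F1 \/ A `<=` F2.

Definition matroid_axiom (T : finType) (B : {set {set T}}) : bool :=
  (B != finset.set0) &&
  [forall X in B, forall Y in B, forall a in X :\: Y,
     exists b in Y :\: X, (b |: X :\ a)%SET \in B].

Record matroid (T : finType) := Matroid {
  bases : {set {set T}};
  basesP : matroid_axiom bases
}.

HB.instance Definition _ (T : finType) := [isSub for @bases T].
HB.instance Definition _ (T : finType) := [Finite of matroid T by <:].

Definition has_rank (T : finType) (r : nat) (M : matroid T) : Prop :=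
  forall X, X \in bases M -> #|X| = r.

(* E_n = [n] u [n]^*, identified with [2n]; with 0-based indices the involution
   i^* = 2n+1-i is i |-> 2n-1-i. *)
Definition E (n : nat) := 'I_(2 * n).

Definition star (n : nat) (i : E n) : E n := rev_ord i.

Definition admissible (n : nat) (A : {set E n}) : bool :=
  [forall i in A, star i \notin A].

(* A linear order on E_n is given by its ranking s (i precedes j iff s i < s j).
   It is admissible (i < j implies j^* < i^* ) iff s commutes with star. *)
Definition admissible_order (n : nat) (s : {perm E n}) : bool :=
  [forall i, s (star i) == star (s i)].

(* Gale order on equicardinal subsets: termwise comparison of the increasing
   enumerations with respect to the order s. *)
Definition gale (n : nat) (s : {perm E n}) (A B : {set E n}) : bool :=
  let ranks X := sort leq [seq nat_of_ord (s i) | i <- enum (X : {set E n})] in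
  all2 leq (ranks A) (ranks B).

(* Symplectic matroids of rank k (Borovik-Gelfand-White). *)
Definition BC_matroid_axiom (n k : nat) (B : {set {set E n}}) : bool :=
  [&& B != finset.set0,
      [forall X in B, admissible X && (#|X| == k)] &
      [forall s : {perm E n}, admissible_order s ==>
         [exists X in B, forall Y in B, gale s Y X]]].

Record BC_matroid (n k : nat) := BCMatroid {
  BC_bases : {set {set E n}};
  BC_basesP : BC_matroid_axiom k BC_bases
}.

HB.instance Definition _ (n k : nat) := [isSub for @BC_bases n k].
HB.instance Definition _ (n k : nat) := [Finite of BC_matroid n k by <:].

(* Pluecker coordinates x_{i,j} are indexed by the pairs i < j. *)
Definition pair2 (n : nat) := {p : E n * E n | (p.1 < p.2)%N}.

HB.instance Definition _ (n : nat) := Finite.on (pair2 n).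

Definition fst2 (n : nat) (p : pair2 n) : E n := (val p).1.
Definition snd2 (n : nat) (p : pair2 n) : E n := (val p).2.
Definition set2 (n : nat) (p : pair2 n) : {set E n} :=
  [set fst2 p; snd2 p]%SET.

Definition pluecker_space (K : fieldType) (n : nat) :=
  projective K #|{: pair2 n}|.

HB.instance Definition _ (K : fieldType) (n : nat) :=
  Topological.on (pluecker_space K n).

Definition pluecker (K : fieldType) (n : nat) (u v : 'rV[K]_(2 * n)) :
  'rV[K]_#|{: pair2 n}| :=
  \row_k let p : pair2 n := enum_val k in
    u 0 (fst2 p) * v 0 (snd2 p) - u 0 (snd2 p) * v 0 (fst2 p).

Definition pcoord (K : fieldType) (n : nat) (x : pluecker_space K n)
  (p : pair2 n) : K := hcoord x (enum_rank p).

Definition Gr (K : fieldType) (n : nat) : set (pluecker_space K n) :=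
  [set x | exists (W : {vspace 'rV[K]_(2 * n)}) (u v : 'rV[K]_(2 * n)),
     [/\ \dim W = 2%N, basis_of W [:: u; v] & val x = <[pluecker u v]>%VS]].
Arguments Gr : clear implicits.

(* The pairs i < j with j = i^* are exactly the pairs (i, i^* ), i in [n]. *)
Definition hyperplane (K : fieldType) (n : nat) : set (pluecker_space K n) :=
  [set x | \sum_(p : pair2 n | snd2 p == star (fst2 p)) pcoord x p = 0].
Arguments hyperplane : clear implicits.

Definition SpG (K : fieldType) (n : nat) : set (pluecker_space K n) :=
  Gr K n `&` hyperplane K n.
Arguments SpG : clear implicits.

Definition thin_cell (K : fieldType) (n : nat) (M : matroid (E n)) :
  set (pluecker_space K n) :=
  [set x | Gr K n x /\
     [set set2 p | p : pair2 n & pcoord x p != 0]%SET = bases M].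
Arguments thin_cell K {n} M _.

Definition sympl_bases (K : fieldType) (n : nat) (x : pluecker_space K n) :
  {set {set E n}} :=
  [set set2 p | p : pair2 n & admissible (set2 p) && (pcoord x p != 0)]%SET.

(* [thin_SpG K N] is SpG_N; the condition says M(x) = N. *)
Definition thin_SpG (K : fieldType) (n : nat) (N : BC_matroid n 2) :
  set (pluecker_space K n) :=
  [set x | SpG K n x /\ sympl_bases x = BC_bases N].
Arguments thin_SpG K {n} N _.

Definition representable (K : fieldType) (n : nat) : set (BC_matroid n 2) :=
  [set N | exists2 x, SpG K n x & sympl_bases x = BC_bases N].
Arguments representable : clear implicits.

Definition is_disjoint_union (T I : Type) (A : set T) (D : set I)
  (F : I -> set T) : Prop :=
  A = \bigcup_(i in D) F i /\ trivIset D F.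

Definition decomposes (K : fieldType) (n : nat) (N : BC_matroid n 2)
  (D : set (matroid (E n))) : Prop :=
  (forall M, D M -> has_rank 2 M) /\
  is_disjoint_union (thin_SpG K N) D
    (fun M => thin_cell K M `&` hyperplane K n).
Arguments decomposes K {n} N D.

(* Main.v *)
Require Import Defs.
From mathcomp Require Import all_boot all_order all_fingroup all_algebra.
From mathcomp Require Import boolp classical_sets reals topology complex.
From mathcomp Require Import mpoly ring zify.

Set Implicit Arguments.
Unset Strict Implicit.
Unset Printing Implicit Defensive.

Import GRing.Theory Num.Theory.
Local Open Scope ring_scope.

(** A point of the Grassmannian is spanned by two rows [u], [v]; it is viewed
    as a configuration of plane vectors c_i = (u_i, v_i), i in E_n, with
    Pluecker coordinates the minors det(c_i, c_j), and the hyperplane section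
    is the vanishing of the form Q = sum of det(c_i, c_(i* )) over i < i*.

    The matroids.  Two-rowed configurations satisfy the exchange axiom since
    parallelism of nonzero plane vectors is an equivalence relation
    ([minor_trans]).  For the symplectic axiom ([minor_pairs_BC]), the greedy
    pair for an admissible order is Gale-maximal among all bases; it cannot be
    of the form {i, i*}, for then every other summand of Q would vanish, but not this one.
    Hence SpG is the union of the SpG_N, and each SpG_N is the union of the
    G_M meeting it, cut by the hyperplane.  These are all locally closed because
    the Grassmannian is closed: it is cut out by the three-term Pluecker
    relations ([Gr_pluecker]).

    Irreducibility of SpG_N ([thin_SpG_irreducible]).  A set is irreducible as
    soon as any two of its points lie on a rational curve generically contained
    in it.  Given configurations c and d with the same admissible bases and
    Q = 0, the loops agree ([sform_loop]), and interpolating the parallel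
    classes and the scalars linearly gives a polynomial configuration e(t) from
    c to d in which every admissible pair that is not a basis stays parallel
    ([interpolate]).  Only Q(e) = 0 may fail, and this is repaired by moving a
    single vector e_m ([joining_curve]): with D = det(e_k, e_(m* )), replacing
    e_m by D e_m - (sign) Q e_k and every other e_j by D e_j multiplies the
    endpoints by nonzero scalars and makes Q vanish.  This is allowed when D
    does not vanish at the endpoints and e_k stays parallel to whatever must
    stay parallel to e_m.  If no such m and k exist, then every pair e_i, e_(i* )
    is parallel and Q(e) is already zero.  The nonvanishing conditions hold at
    the endpoints, hence for all but finitely many t.

    The generic matroid ([unique_dense_cell]).  The irreducible SpG_N is covered
    by the closures of the finitely many cells, so one of these closures
    contains it.  Two cells with the same closure meet, as a locally closed
    set is open in its closure; so disjointness gives uniqueness. *)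

(** * Minors of two-rowed configurations and the symplectic form *)

Section Minor.
Variables (A : comNzRingType) (I : Type).
Implicit Types (u v : I -> A) (i j k l : I).

(** The minor of columns [i] and [j] of the two-rowed matrix with rows [u], [v]. *)
Definition minor u v i j : A := u i * v j - u j * v i.

Lemma minorC u v i j : minor u v j i = - minor u v i j.
Proof. by rewrite /minor; ring. Qed.

Lemma minorxx u v i : minor u v i i = 0.
Proof. by rewrite /minor; ring. Qed.

End Minor.

Lemma minor_eq0C (A : comNzRingType) (I : Type) (u v : I -> A) i j :
  (minor u v j i == 0) = (minor u v i j == 0).
Proof. by rewrite minorC oppr_eq0. Qed.

(** The plane vector (u_i, v_i) is nonzero. *)
Definition nonloop (A : comNzRingType) (I : Type) (u v : I -> A) i : bool :=
  (u i != 0) || (v i != 0).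

Section MinorDomain.
Variables (A : idomainType) (I : Type) (u v : I -> A).

(** Parallelism of plane vectors is transitive through a nonzero vector. *)
Lemma minor_trans i j k : nonloop u v i ->
  minor u v i j = 0 -> minor u v i k = 0 -> minor u v j k = 0.
Proof.
move=> nz ij ik.
have Eu : u i * minor u v j k = u j * minor u v i k - u k * minor u v i j.
  by rewrite /minor; ring.
have Ev : v i * minor u v j k = v j * minor u v i k - v k * minor u v i j.
  by rewrite /minor; ring.
move: Eu Ev; rewrite ij ik !mulr0 subrr => /eqP Eu /eqP Ev.
apply/eqP; move: Eu Ev nz; rewrite !mulf_eq0 /nonloop.
by case: (u i == 0) => //=; case: (v i == 0).
Qed.

Lemma minor_nonloop i j : minor u v i j != 0 -> nonloop u v i.
Proof.
apply: contraNT; rewrite negb_or !negbK => /andP[/eqP ui /eqP vi].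
by rewrite /minor ui vi mul0r mulr0 subrr.
Qed.

End MinorDomain.

Lemma starK n : involutive (@star n).
Proof. exact: rev_ordK. Qed.

Lemma val_star n (i : E n) : star i = (2 * n - i.+1)%N :> nat.
Proof. by []. Qed.

(* Keeps simplification from exposing the truncated subtraction in [star i]. *)
#[local] Opaque star.

Lemma star_neq n (i : E n) : star i != i.
Proof.
apply/eqP => /(congr1 (fun j : E n => nat_of_ord j)); rewrite val_star.
move=> Ei; have := ltn_ord i; rewrite -subn_gt0 => ?.
have : odd (2 * n) by rewrite -(subnK (ltn_ord i)) Ei addnS oddS oddD addbb.
by rewrite mul2n odd_double.
Qed.

Lemma ltn_star n (i : E n) : (star i < i)%N = ~~ (i < star i)%N.
Proof.
rewrite -leqNgt [RHS]leq_eqVlt; case: eqP => //= Ei.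
by have /eqP[] := star_neq i; apply: val_inj.
Qed.

Section SymplecticForm.
Variable n : nat.

(** The form Q defining the symplectic hyperplane, with the pairs {i, i*}
    enumerated by their smaller element. *)
Definition sform (A : comNzRingType) (u v : E n -> A) : A :=
  \sum_(i : E n | (i < star i)%N) minor u v i (star i).

Lemma sform_pairs (A : comNzRingType) (u v : E n -> A) :
  \sum_(p : pair2 n | snd2 p == star (fst2 p)) minor u v (fst2 p) (snd2 p)
  = sform u v.
Proof.
rewrite /sform.
have H : forall i : E n, (i < star i)%N -> ((i, star i).1 < (i, star i).2)%N by [].
pose h (i : E n) : option (pair2 n) := insub (i, star i).
case: (pickP (fun p : pair2 n => snd2 p == star (fst2 p))) => [p0 _|no]; last first.
  rewrite [LHS]big_pred0 // [RHS]big_pred0 // => i; apply/negbTE/negP => Hi.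
  by have := no (exist _ (i, star i) Hi); rewrite /= eqxx.
rewrite [RHS](reindex_onto (@fst2 n) (fun i => odflt p0 (h i))); last first.
  by move=> i Hi; rewrite /h insubT.
apply: eq_big => [p|p /eqP ->//].
apply/idP/andP => [/eqP Ep|[Hi /eqP Ep]].
  have Hp : (fst2 p < star (fst2 p))%N by rewrite -Ep; exact: (valP p).
  split=> //; rewrite /h insubT /=; apply/eqP/val_inj => /=.
  by rewrite -Ep [RHS]surjective_pairing.
by rewrite -Ep /h insubT.
Qed.

(** The summand of the pair {m, m*} is isolated up to a sign that depends on
    [m] only, not on the configuration or the ring. *)
Lemma sform_split m : exists e : bool, forall (A : comNzRingType) (u v : E n -> A),
  sform u v = (-1) ^+ e * minor u v m (star m)
    + \sum_(i : E n | [&& (i < star i)%N, i != m & i != star m])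
        minor u v i (star i).
Proof.
exists (star m < m)%N => A u v; rewrite /sform ltn_star.
have [lt|ge] := boolP (m < star m)%N => /=.
  rewrite expr0 mul1r (bigD1 m) //; congr (_ + _); apply: eq_bigl => i.
  case: (boolP (i == star m)) => [/eqP ->|]; last by rewrite andbT.
  by rewrite starK ltn_star lt andbF.
rewrite expr1 mulN1r -minorC (bigD1 (star m)) /=; last first.
  by rewrite starK ltn_star ge.
rewrite starK; congr (_ + _); apply: eq_bigl => i.
case: (boolP (i == m)) => [/eqP ->|]; last by [].
by rewrite (negPf ge).
Qed.

End SymplecticForm.

Section Loops.
Variables (K : fieldType) (n : nat).
Implicit Types u v : E n -> K.

(** On the hyperplane the loops can be read off the admissible bases: an index
    [i] that lies in no admissible basis is a loop.  Otherwise all vectors but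
    the one at i* would be parallel to c_i, so Q = 0 would reduce to
    det(c_i, c_(i* )) = 0 and all minors would vanish. *)
Lemma sform_loop u v i a b : sform u v = 0 -> minor u v a b != 0 ->
  nonloop u v i -> exists2 j, j != star i & minor u v i j != 0.
Proof.
move=> Q0 ab nl; apply: contrapT => no.
have iso j : j != star i -> minor u v i j = 0.
  by move=> ji; apply/eqP/negPn/negP => ?; apply: no; exists j.
have iis : minor u v i (star i) = 0.
  have [e He] := sform_split i.
  move: Q0; rewrite He big1 ?addr0.
    by move/eqP; rewrite mulf_eq0 signr_eq0 => /eqP.
  move=> j /and3P[_ ji jsi]; apply: (minor_trans nl); apply: iso => //.
  by rewrite (inj_eq (can_inj (@starK n))).
have all0 j : minor u v i j = 0.
  by have [->|/iso] := eqVneq j (star i).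
by move: ab; rewrite (minor_trans nl (all0 a) (all0 b)) eqxx.
Qed.

End Loops.

(** * A polynomial curve joining two configurations *)

Section Interpolate.
Variables (K : fieldType).

(** The affine polynomial with value [a] at 0 and [b] at 1. *)
Definition lerp (a b : K) : {poly K} := a%:P + (b - a) *: 'X.

Lemma lerp0 a b : (lerp a b).[0] = a.
Proof. by rewrite /lerp !hornerE. Qed.

Lemma lerp1 a b : (lerp a b).[1] = b.
Proof. by rewrite /lerp hornerD hornerC hornerZ hornerX mulr1 addrC subrK. Qed.

Lemma parallel_scale (I : Type) (u v : I -> K) i j : nonloop u v j ->
  minor u v i j = 0 -> exists l, u i = l * u j /\ v i = l * v j.
Proof.
move=> /orP[] nz /eqP; rewrite subr_eq0 => /eqP Em.
  exists (u i / u j); split; first by rewrite divfK.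
  by apply: (mulfI nz); rewrite -Em mulrA; congr (_ * _); rewrite mulrC divfK.
exists (v i / v j); split; last by rewrite divfK.
by apply: (mulIf nz); rewrite Em mulrAC divfK // mulrC.
Qed.

(** Two configurations with the same loops are joined by a polynomial family
    that keeps parallel any two indices that are parallel at both ends: each
    vector is written as a multiple of the representative of its common parallel
    class, and multiples and representatives are interpolated separately. *)
Lemma interpolate (I : finType) (u v u' v' : I -> K) :
  (forall i, nonloop u v i = nonloop u' v' i) ->
  exists U V : I -> {poly K},
    [/\ forall i, (U i).[0] = u i /\ (V i).[0] = v i,
        forall i, (U i).[1] = u' i /\ (V i).[1] = v' i,
        forall i, ~~ nonloop u v i -> U i = 0 /\ V i = 0 &
        forall i j, minor u v i j = 0 -> minor u' v' i j = 0 ->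
          minor U V i j = 0].
Proof.
move=> nlE.
pose r i j := [&& nonloop u v i, nonloop u v j, minor u v i j == 0
               & minor u' v' i j == 0].
have rxx i : nonloop u v i -> r i i by move=> nl; rewrite /r nl !minorxx eqxx.
have rC i j : r i j -> r j i.
  by case/and4P=> ni nj m1 m2; rewrite /r ni nj !(minor_eq0C _ _ i j) m1 m2.
have rT i j k : r i j -> r i k -> r j k.
  case/and4P=> ni nj /eqP m1 /eqP m2 /and4P[_ nk /eqP m3 /eqP m4].
  rewrite /r nj nk (minor_trans ni m1 m3); rewrite nlE in ni.
  by rewrite (minor_trans ni m2 m4) eqxx.
pose rep i := odflt i [pick j | r i j].
have rrep i : nonloop u v i -> r i (rep i).
  by move=> nl; rewrite /rep; case: pickP => //= /(_ i); rewrite rxx.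
have repE i j : r i j -> rep i = rep j.
  move=> rij; rewrite /rep.
  have Er : r i =1 r j.
    move=> k; apply/idP/idP => [|rjk]; first exact: rT.
    exact: rT (rC _ _ rij) rjk.
  rewrite (eq_pick Er); case: pickP => //= /(_ i).
  by rewrite (rC _ _ rij).
have /choice[l Hl] i : exists lm : K * K,
    [/\ u i = lm.1 * u (rep i) /\ v i = lm.1 * v (rep i),
        u' i = lm.2 * u' (rep i) /\ v' i = lm.2 * v' (rep i) &
        ~~ nonloop u v i -> lm = (0, 0)].
  have [nl|nnl] := boolP (nonloop u v i).
    have /and4P[_ nr /eqP m1 /eqP m2] := rrep i nl.
    have [a Ha] := parallel_scale nr m1; rewrite nlE in nr.
    by have [b Hb] := parallel_scale nr m2; exists (a, b); split.
  exists (0, 0); split=> //=; rewrite !mul0r; last rewrite nlE in nnl.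
    by move: nnl; rewrite negb_or !negbK => /andP[/eqP ? /eqP ?].
  by move: nnl; rewrite negb_or !negbK => /andP[/eqP ? /eqP ?].
exists (fun i => lerp (l i).1 (l i).2 * lerp (u (rep i)) (u' (rep i))).
exists (fun i => lerp (l i).1 (l i).2 * lerp (v (rep i)) (v' (rep i))).
have loop0 i : ~~ nonloop u v i -> lerp (l i).1 (l i).2 = 0.
  by have [_ _ H] := Hl i => /H ->; rewrite /lerp subrr scale0r addr0.
split.
- by move=> i; rewrite !hornerM !lerp0; have [[<- <-] _ _] := Hl i.
- by move=> i; rewrite !hornerM !lerp1; have [_ [<- <-] _] := Hl i.
- by move=> i /loop0 ->; rewrite !mul0r.
move=> i j m1 m2; rewrite /minor.
have [ni|/loop0 ->] := boolP (nonloop u v i); last by ring.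
have [nj|/loop0 ->] := boolP (nonloop u v j); last by ring.
by rewrite (repE i j) ?/r ?ni ?nj ?m1 ?m2 ?eqxx //; ring.
Qed.

End Interpolate.

Lemma horner_minor (K : comNzRingType) (I : Type) (U V : I -> {poly K}) t i j :
  (minor U V i j).[t] = minor (fun k => (U k).[t]) (fun k => (V k).[t]) i j.
Proof. by rewrite /minor hornerD hornerN !hornerM. Qed.

Lemma horner_sform (K : comNzRingType) n (U V : E n -> {poly K}) t :
  (sform U V).[t] = sform (fun k => (U k).[t]) (fun k => (V k).[t]).
Proof.
by rewrite /sform horner_sum; apply: eq_bigr => i _; rewrite horner_minor.
Qed.

Section Curve.
Variables (K : fieldType) (n : nat) (u v u' v' : E n -> K).
Hypotheses (Q0 : sform u v = 0) (Q0' : sform u' v' = 0).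
Hypothesis (nz : exists a b, minor u v a b != 0).
(* The two configurations have the same admissible bases. *)
Hypothesis pat : forall i j, j != star i ->
  (minor u v i j == 0) = (minor u' v' i j == 0).

Lemma pattern_nonzero : exists a b, minor u' v' a b != 0.
Proof.
have [a [b ab]] := nz; have [j ja aj] := sform_loop Q0 ab (minor_nonloop ab).
by exists a, j; rewrite -pat.
Qed.

Lemma pattern_nonloop i : nonloop u v i = nonloop u' v' i.
Proof.
have [a [b ab]] := nz; have [a' [b' ab']] := pattern_nonzero.
apply/idP/idP => nl.
  have [j ji m] := sform_loop Q0 ab nl.
  by rewrite pat // in m; apply: minor_nonloop m.
have [j ji m] := sform_loop Q0' ab' nl.
by rewrite -pat // in m; apply: minor_nonloop m.
Qed.

(** Two configurations on the hyperplane with the same admissible bases are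
    joined, up to nonzero scalars, by a polynomial family inside the hyperplane
    along which the admissible nonbases remain nonbases. *)
Lemma joining_curve : exists (U V : E n -> {poly K}) (a b : K),
  [/\ a != 0 /\ b != 0,
      forall i, (U i).[0] = a * u i /\ (V i).[0] = a * v i,
      forall i, (U i).[1] = b * u' i /\ (V i).[1] = b * v' i,
      sform U V = 0 &
      forall i j, j != star i -> minor u v i j = 0 -> minor U V i j = 0].
Proof.
have [U [V [H0 H1 Hl Hm]]] := interpolate pattern_nonloop.
have U0 : (fun k => (U k).[0]) = u by apply/funext => k; case: (H0 k).
have V0 : (fun k => (V k).[0]) = v by apply/funext => k; case: (H0 k).
have U1 : (fun k => (U k).[1]) = u' by apply/funext => k; case: (H1 k).
have V1 : (fun k => (V k).[1]) = v' by apply/funext => k; case: (H1 k).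
have Hz i j : j != star i -> minor u v i j = 0 -> minor U V i j = 0.
  by move=> ij m0; apply: Hm => //; apply/eqP; rewrite -pat // m0.
(* Any such m, k allow Q to be corrected by moving e_m in the direction e_k. *)
have [[m [k [ck dk Hk]]]|no] := pselect (exists m k,
  [/\ minor u v k (star m) != 0, minor u' v' k (star m) != 0 &
      forall j, j != m -> j != star m -> minor u v m j = 0 ->
        minor U V j k = 0]).
  have [e He] := sform_split m.
  pose D := minor U V k (star m); pose Q := sform U V.
  (* The corrected rows; only the entry at m changes direction. *)
  pose mv (X : E n -> {poly K}) i :=
    if i == m then D * X m - (-1) ^+ e * Q * X k else D * X i.
  have D0 : D.[0] = minor u v k (star m) by rewrite horner_minor U0 V0.
  have D1 : D.[1] = minor u' v' k (star m) by rewrite horner_minor U1 V1.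
  have q0 : Q.[0] = 0 by rewrite horner_sform U0 V0.
  have q1 : Q.[1] = 0 by rewrite horner_sform U1 V1.
  have mvm X : mv X m = D * X m - (-1) ^+ e * Q * X k by rewrite /mv eqxx.
  have mvE X i : i != m -> mv X i = D * X i by rewrite /mv => /negPf ->.
  have mv0 X i : (mv X i).[0] = D.[0] * (X i).[0].
    have [->|im] := eqVneq i m; last by rewrite mvE // hornerM.
    by rewrite mvm hornerD hornerN !hornerM q0 mulr0 mul0r subr0.
  have mv1 X i : (mv X i).[1] = D.[1] * (X i).[1].
    have [->|im] := eqVneq i m; last by rewrite mvE // hornerM.
    by rewrite mvm hornerD hornerN !hornerM q1 mulr0 mul0r subr0.
  have zm j : j != star m -> minor u v m j = 0 -> minor (mv U) (mv V) m j = 0.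
    have [->|jm jsm m0] := eqVneq j m; first by move=> _ _; rewrite minorxx.
    have -> : minor (mv U) (mv V) m j =
        D * D * minor U V m j + (-1) ^+ e * Q * D * minor U V j k.
      by rewrite /minor !mvm !mvE //; ring.
    by rewrite Hz // Hk // !mulr0 addr0.
  exists (mv U), (mv V), (minor u v k (star m)), (minor u' v' k (star m)).
  split=> //.
  - by move=> i; rewrite !mv0 D0; have [-> ->] := H0 i.
  - by move=> i; rewrite !mv1 D1; have [-> ->] := H1 i.
  - rewrite He.
    under eq_bigr => i /and3P[_ im ism].
      have sim : star i != m.
        by apply: contraNneq ism => <-; rewrite starK.
      have -> : minor (mv U) (mv V) i (star i) = D ^+ 2 * minor U V i (star i).
        by rewrite /minor !mvE //; ring.
      over.
    rewrite -mulr_sumr.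
    have Er := He _ U V; rewrite -/Q in Er.
    have -> : minor (mv U) (mv V) m (star m) =
        D * D * minor U V m (star m) - (-1) ^+ e * Q * D * D.
      rewrite {3}/D /minor !mvm !mvE ?star_neq //; ring.
    have ee : ((-1) ^+ e * (-1) ^+ e : {poly K}) = 1.
      by rewrite -expr2 sqrr_sign.
    set S := \sum_(i | _) _ in Er *.
    rewrite mulrBr !mulrA ee mul1r.
    have -> : S = Q - (-1) ^+ e * minor U V m (star m) by rewrite Er addrC addKr.
    ring.
  - move=> i j ji m0; have [im|im] := eqVneq i m.
      by rewrite im; apply: zm; rewrite -im.
    have [jm|jm] := eqVneq j m.
      rewrite jm minorC zm ?oppr0 //; last by rewrite -jm minorC m0 oppr0.
      by apply: contraNneq ji => ->; rewrite starK jm.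
    have -> : minor (mv U) (mv V) i j = D ^+ 2 * minor U V i j.
      by rewrite /minor !mvE //; ring.
    by rewrite Hz // mulr0.
(* Without such m, k the family already satisfies Q = 0, term by term: a pair
   m, m* that is nonparallel along the family contradicts the choice k = m, or
   the choice of any k forming a basis with m*. *)
exists U, V, 1, 1; split; rewrite ?oner_eq0 //.
- by move=> i; rewrite !mul1r.
- by move=> i; rewrite !mul1r.
apply: big1 => m _; apply/eqP/negPn/negP => mm.
have nlE i : nonloop U V i -> nonloop u v i.
  apply: contraLR => /Hl[Ui Vi]; by rewrite /nonloop Ui Vi eqxx.
have nlm := nlE _ (minor_nonloop mm).
have nlsm : nonloop u v (star m).
  by apply/nlE/(@minor_nonloop _ _ _ _ _ m); rewrite minor_eq0C.
have noA : minor u v m (star m) = 0 \/ minor u' v' m (star m) = 0.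
  apply: contrapT => /not_orP[/eqP cm /eqP dm]; apply: no; exists m, m.
  split=> // j jm jsm m0; rewrite minorC Hz ?oppr0 //.
have [a [b ab]] := nz.
have [k] := sform_loop Q0 ab nlsm; rewrite starK => km mk.
have [j [jm jsm m0 jk]] : exists j, [/\ j != m, j != star m, minor u v m j = 0 &
    minor U V j k != 0].
  apply: contrapT => noj; apply: no; exists m, k; split.
  - by rewrite minor_eq0C.
  - have kms : star m != star k by rewrite (inj_eq (can_inj (@starK n))) eq_sym.
    by rewrite -(pat kms) minor_eq0C.
  move=> j jm jsm m0; apply/eqP/negPn/negP => ?; apply: noj.
  by exists j.
have nlj := nlE _ (minor_nonloop jk).
have m0' : minor u' v' m j = 0 by apply/eqP; rewrite -pat // m0.
have smj : star m != star j by rewrite (inj_eq (can_inj (@starK n))) eq_sym.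
have [jsm0|jsmN] := eqVneq (minor u v j (star m)) 0.
  have jsm0' : minor u' v' j (star m) = 0 by apply/eqP; rewrite -pat // jsm0.
  move: mm; rewrite Hm ?eqxx //.
    by apply: (minor_trans nlj) => //; rewrite minorC m0 oppr0.
  rewrite pattern_nonloop in nlj.
  by apply: (minor_trans nlj) => //; rewrite minorC m0' oppr0.
case: noA => mz.
  by move: jsmN; rewrite (minor_trans nlm m0 mz) eqxx.
rewrite pattern_nonloop in nlm.
by move: jsmN; rewrite pat // (minor_trans nlm m0' mz) eqxx.
Qed.

End Curve.

(** * The matroid and the symplectic matroid of a configuration *)

Section Pairs.
Variables (n : nat) (K : fieldType).
Implicit Types (u v : E n -> K).

(** The bases of the rank 2 matroid of the configuration. *)
Definition minor_pairs u v : {set {set E n}} :=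
  [set set2 p | p : pair2 n & minor u v (fst2 p) (snd2 p) != 0]%SET.

Lemma set2C (T : finType) (i j : T) : [set i; j]%SET = [set j; i]%SET.
Proof. exact: finset.setUC. Qed.

Lemma set2_inj (i j k l : E n) : [set i; j]%SET = [set k; l]%SET ->
  (i = k /\ j = l) \/ (i = l /\ j = k).
Proof.
move=> /setP H.
have := H i; rewrite !inE eqxx /= => /esym/orP[]/eqP ?; subst.
  left; split=> //; have := H j; rewrite !inE eqxx orbT => /esym/orP[]/eqP //.
  move=> ?; subst; have := H l; rewrite !inE eqxx !orbT orbb => /eqP //.
right; split=> //; have := H j; rewrite !inE eqxx orbT => /esym/orP[]/eqP //.
move=> ?; subst; have := H k; rewrite !inE eqxx orbb => /eqP //.
Qed.

Lemma mem_minor_pairs u v i j :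
  ([set i; j]%SET \in minor_pairs u v) = (minor u v i j != 0).
Proof.
apply/imsetP/idP => [[p]|ij].
  rewrite inE => mp /set2_inj[] [-> ->] //.
  by rewrite minor_eq0C.
wlog lt : i j ij / (i < j)%N.
  move=> W; have : i != j by apply: contraNneq ij => ->; rewrite minorxx.
  rewrite -(inj_eq val_inj) /= neq_ltn => /orP[] lt; first exact: W lt.
  by rewrite set2C; apply: W lt; rewrite minor_eq0C.
pose p : pair2 n := exist _ (i, j) lt.
by exists p; rewrite ?inE.
Qed.

Lemma minor_pairsP u v X : X \in minor_pairs u v ->
  exists i j, X = [set i; j]%SET /\ minor u v i j != 0.
Proof.
by case/imsetP => p; rewrite inE => mp ->; exists (fst2 p), (snd2 p).
Qed.

Lemma minor_neq u v i j : minor u v i j != 0 -> i != j.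
Proof. by apply: contraNneq => ->; rewrite minorxx. Qed.

Lemma minor_pairs_matroid u v : (exists i j, minor u v i j != 0) ->
  matroid_axiom (minor_pairs u v).
Proof.
move=> [i [j ij]]; apply/andP; split.
  by apply/set0Pn; exists [set i; j]%SET; rewrite mem_minor_pairs.
apply/forall_inP => X /minor_pairsP[x [y [-> xy]]].
apply/forall_inP => Y /minor_pairsP[z [t [-> zt]]].
apply/forall_inP => a; rewrite !inE => /andP[aY aX].
wlog ax : x y xy aX / a = x.
  move=> W; case/orP: (aX) => /eqP Ea; first exact: W Ea.
  rewrite (set2C x y); apply: (W y x) => //; [by rewrite minor_eq0C|by rewrite orbC].
subst a.
have nly : nonloop u v y by apply: (@minor_nonloop _ _ _ _ y x); rewrite minor_eq0C.
have [b bY yb] : exists2 b, b \in [set z; t]%SET & minor u v y b != 0.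
  have [yz|yz] := eqVneq (minor u v y z) 0; last first.
    by exists z; rewrite ?inE ?eqxx.
  exists t; rewrite ?inE ?eqxx ?orbT //.
  by apply: contraNneq zt => yt; rewrite (minor_trans nly yz yt).
apply/existsP; exists b; rewrite !inE in bY *.
have bx : b != x by apply: contraNneq aY => <-.
rewrite bY (negPf bx) eq_sym (negPf (minor_neq yb)) /=.
have -> : [set x; y]%SET :\ x = [set y]%SET.
  by apply/setP => k; rewrite !inE; case: eqVneq => //= ->;
     rewrite (negPf (minor_neq xy)).
by rewrite mem_minor_pairs minor_eq0C.
Qed.

(** The greedy basis for an admissible order is termwise maximal among all
    bases, and it is admissible if the configuration is on the hyperplane: were
    it {x, x*}, each other pair i, i* would contain a loop or consist of two vectors
    parallel to c_x, so Q would reduce to det(c_x, c_(x* )), up to sign. *)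
Lemma greedy_pair u v (s : {perm E n}) : admissible_order s ->
  sform u v = 0 -> (exists i j, minor u v i j != 0) ->
  exists x y, [/\ y != star x, minor u v x y != 0, (s y <= s x)%N &
    forall i j, minor u v i j != 0 ->
      (maxn (s i) (s j) <= s x)%N /\ (minn (s i) (s j) <= s y)%N].
Proof.
move=> /forallP adm Q0 [i0 [j0 ij0]].
case: (@arg_maxnP _ i0 (nonloop u v) (fun i => s i)).
  exact: minor_nonloop ij0.
move=> x nlx xmax.
have [y0 xy0] : exists y, minor u v x y != 0.
  have [xi|] := eqVneq (minor u v x i0) 0; last by exists i0.
  have [xj|] := eqVneq (minor u v x j0) 0; last by exists j0.
  by move: ij0; rewrite (minor_trans nlx xi xj) eqxx.
case: (@arg_maxnP _ y0 (fun y => minor u v x y != 0) (fun i => s i)) => // y xy ymax.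
have nly : nonloop u v y by apply: (@minor_nonloop _ _ _ _ y x); rewrite minor_eq0C.
exists x, y; split=> //; last 1 first.
- move=> i j ij.
  have nli := minor_nonloop ij.
  have nlj : nonloop u v j by apply: (@minor_nonloop _ _ _ _ j i); rewrite minor_eq0C.
  split; first by rewrite geq_max; apply/andP; split; apply: xmax.
  rewrite geq_min.
  have [xi|xi] := eqVneq (minor u v x i) 0; last by have /= -> := ymax _ xi.
  have [xj|xj] := eqVneq (minor u v x j) 0; last first.
    by have /= -> := ymax _ xj; rewrite orbT.
  by move: ij; rewrite (minor_trans nlx xi xj) eqxx.
- apply: contraNneq xy => Ey; apply/eqP.
  have [e He] := sform_split x.
  move: Q0; rewrite He big1 ?addr0; last first.
    move=> i /and3P[_ ix isx].
    have sE (k : E n) : s (star k) = (2 * n - (s k).+1)%N :> nat.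
      by rewrite (eqP (adm k)) val_star.
    have [nli|] := boolP (nonloop u v i); last first.
      by move=> nl; apply/eqP; apply: contraNT nl => H; apply: minor_nonloop H.
    have [nlsi|] := boolP (nonloop u v (star i)); last first.
      move=> nl; apply/eqP; apply: contraNT nl => H.
      by apply: (@minor_nonloop _ _ _ _ _ i); rewrite minor_eq0C.
    have /= := xmax _ nli; have /= := xmax _ nlsi.
    have := sE i; have := sE x.
    have := ltn_ord (s i); have := ltn_ord (s x).
    (* An index other than x* = y of rank at least that of y is parallel to x, by
       the choice of y. *)
    have key k : k != star x -> (s (star x) <= s k)%N -> minor u v x k = 0.
      move=> kx le; apply/eqP/negPn/negP => /ymax /=; rewrite Ey => le2.
      case/negP: kx; apply/eqP/(@perm_inj _ s)/val_inj/anti_leq.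
      by rewrite le le2.
    move=> ? ? ? ? ? ?; apply: (minor_trans nlx); apply: key => //.
    - by rewrite /=; lia.
    - by rewrite (inj_eq (can_inj (@starK n))).
    - by rewrite /=; lia.
  by rewrite Ey; move/eqP; rewrite mulf_eq0 signr_eq0 => /eqP.
- exact: xmax.
Qed.

Lemma sorted_ranks (s : {perm E n}) (i j : E n) : i != j ->
  sort leq [seq nat_of_ord (s k) | k <- enum [set i; j]%SET]
  = [:: minn (s i) (s j); maxn (s i) (s j)].
Proof.
move=> ij.
have -> : [:: minn (s i) (s j); maxn (s i) (s j)]
    = sort leq [:: nat_of_ord (s i); nat_of_ord (s j)].
  by rewrite /sort /= /minn /maxn; case: ltngtP => // ->.
apply/perm_sortP; [exact: leq_total|exact: leq_trans|exact: anti_leq|].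
apply: (@perm_map _ _ (fun k => nat_of_ord (s k)) _ [:: i; j]).
apply: uniq_perm; rewrite ?enum_uniq //=; first by rewrite inE ij.
by move=> k; rewrite mem_enum !inE.
Qed.

Lemma admissible2 (i j : E n) : i != j ->
  admissible [set i; j]%SET = (j != star i).
Proof.
move=> ij; apply/forall_inP/idP => [/(_ i)|ji].
  by rewrite !inE eqxx => /(_ isT); rewrite negb_or => /andP[_]; rewrite eq_sym.
move=> k; rewrite !inE => /orP[] /eqP ->; rewrite negb_or star_neq ?andbT /=.
  by rewrite eq_sym.
by apply: contraNneq ji => <-; rewrite starK.
Qed.

Lemma minor_pairs_BC u v : sform u v = 0 -> (exists i j, minor u v i j != 0) ->
  BC_matroid_axiom 2 [set X in minor_pairs u v | admissible X]%SET.
Proof.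
move=> Q0 nz.
have greedy s : admissible_order s ->
    exists2 X, X \in [set X in minor_pairs u v | admissible X]%SET
    & forall Y, Y \in minor_pairs u v -> gale s Y X.
  move=> adm; have [x [y [yx xy le H]]] := greedy_pair adm Q0 nz.
  exists [set x; y]%SET.
    by rewrite !inE mem_minor_pairs xy admissible2 // (minor_neq xy).
  move=> Y /minor_pairsP[i [j [-> ij]]]; rewrite /gale.
  rewrite !sorted_ranks ?(minor_neq xy) ?(minor_neq ij) //=.
  have [h1 h2] := H _ _ ij.
  by rewrite (minn_idPr le) (maxn_idPl le) h1 h2.
apply/and3P; split.
(* The identity is an admissible order, so the greedy basis exists. *)
- have [|X HX _] := greedy 1%g; first by apply/forallP => i; rewrite !perm1.
  by apply/set0Pn; exists X.
- apply/forall_inP => X; rewrite !inE => /andP[/minor_pairsP[i [j [-> ij]]] ->].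
  by rewrite cards2 (minor_neq ij).
apply/forallP => s; apply/implyP => /greedy[X HX H].
apply/exists_inP; exists X => //; apply/forall_inP => Y.
by rewrite inE => /andP[/H].
Qed.

End Pairs.

Local Open Scope classical_set_scope.

Section PatternSets.
Variables (n : nat) (K : fieldType).
Implicit Types (u v : E n -> K).

Lemma admissible_pairs_eq u v u' v' :
  (forall i j, j != star i -> (minor u v i j == 0) = (minor u' v' i j == 0)) ->
  [set X in minor_pairs u v | admissible X]%SET
  = [set X in minor_pairs u' v' | admissible X]%SET.
Proof.
move=> pat; apply/setP => X; rewrite !inE.
apply/andP/andP => -[/minor_pairsP[i [j [-> ij]]] adm]; split=> //;
  rewrite mem_minor_pairs; move: adm; rewrite admissible2 ?(minor_neq ij) // => ji.
  by rewrite -pat.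
by rewrite pat.
Qed.

Lemma admissible_pairs_pattern u v u' v' :
  [set X in minor_pairs u v | admissible X]%SET
  = [set X in minor_pairs u' v' | admissible X]%SET ->
  forall i j, j != star i -> (minor u v i j == 0) = (minor u' v' i j == 0).
Proof.
move=> /setP H i j ji; have [->|ij] := eqVneq i j; first by rewrite !minorxx.
have := H [set i; j]%SET; rewrite !inE admissible2 // ji !andbT.
by rewrite !mem_minor_pairs => /negb_inj.
Qed.

End PatternSets.

(** * Lines and closed sets of projective space *)

Section Projective.
Variables (K : fieldType) (m : nat).
Implicit Types (x : projective K m) (w : 'rV[K]_m) (S : set {mpoly K[m]}).

Lemma vpick_neq0 x : vpick (val x) != 0.
Proof.
by rewrite vpick0; apply: contraTneq (valP x) => /= ->; rewrite dimv0.
Qed.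

Lemma hcoord_line x w : val x = <[w]>%VS ->
  exists2 a, a != 0 & forall k, hcoord x k = a * w 0 k.
Proof.
move=> xw; have := memv_pick (val x); rewrite {2}xw => /vlineP[a Ea].
exists a; last by move=> k; rewrite /hcoord Ea mxE.
by apply: contraNneq (vpick_neq0 x) => a0; rewrite Ea a0 scale0r.
Qed.

Lemma line_vpick x : val x = <[vpick (val x)]>%VS.
Proof.
apply/esym/eqP; rewrite eqEdim -memvE memv_pick (eqP (valP x)) /=.
by rewrite dim_vline vpick_neq0.
Qed.

Lemma line_point w : w != 0 -> exists x, val x = <[w]>%VS.
Proof.
move=> w0; have d1 : \dim <[w]>%VS == 1%N by rewrite dim_vline w0.
by exists (exist (fun L : {vspace 'rV[K]_m} => \dim L == 1%N) _ d1).
Qed.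

Lemma meval_scale (f : {mpoly K[m]}) d a (w : 'I_m -> K) : f \is d.-homog ->
  f.@[fun k => a * w k] = a ^+ d * f.@[w].
Proof.
move=> /dhomogP hf; rewrite !mevalE mulr_sumr !big_seq.
apply: eq_bigr => mm /hf md.
under eq_bigr do rewrite exprMn.
rewrite big_split /= mulrCA; congr (_ * (_ * _)).
by rewrite prodrXr -mdegE md.
Qed.

Lemma closedP (F : set (projective K m)) : closed F <->
  exists2 S, S `<=` @homogeneous K m & F = zero_locus S.
Proof.
split=> [/closed_openC[S hS FS]|[S hS ->]].
  by exists S => //; rewrite -[F]setCK FS setCK.
by rewrite -[zero_locus S]setCK; apply: open_closedC; exists S.
Qed.

Lemma open_nonzero (f : {mpoly K[m]}) : homogeneous f ->
  open [set x : projective K m | f.@[hcoord x] != 0].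
Proof.
move=> hf; exists [set f]; first by move=> _ ->.
apply/seteqP; split=> x /=; first by move=> /eqP f0 /(_ f erefl).
by move=> H; apply/eqP => f0; apply: H => _ ->.
Qed.

End Projective.

(** * The Grassmannian and its thin cells *)

Section Alternating.
Variable n : nat.

(** The alternating extension to all pairs of indices of a family indexed by the
    pairs i < j; it is zero on the diagonal. *)
Definition alt (A : zmodType) (F : pair2 n -> A) (i j : E n) : A :=
  if insub (i, j) is Some p then F p
  else if insub (j, i) is Some p then - F p else 0.

Lemma alt_pair (A : zmodType) (F : pair2 n -> A) p :
  alt F (fst2 p) (snd2 p) = F p.
Proof.
rewrite /alt; have -> : (fst2 p, snd2 p) = val p by rewrite [RHS]surjective_pairing.
by rewrite valK.
Qed.

Lemma alt_morph (A B : zmodType) (g : {additive A -> B}) (F : pair2 n -> A) i j :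
  g (alt F i j) = alt (g \o F) i j.
Proof.
rewrite /alt; case: insubP => //= _; case: insubP => /= *.
  by rewrite raddfN.
by rewrite raddf0.
Qed.

Lemma alt_minor (A : comNzRingType) (a : A) (u v : E n -> A) i j :
  alt (fun p => a * minor u v (fst2 p) (snd2 p)) i j = a * minor u v i j.
Proof.
rewrite /alt; case: insubP => [p _ Ep|/= ij]; first by rewrite /fst2 /snd2 Ep.
case: insubP => [p _ Ep|/= ji].
  by rewrite /fst2 /snd2 Ep /= minorC mulrN opprK.
have -> : i = j by apply/val_inj/anti_leq; rewrite leqNgt ji leqNgt ij.
by rewrite minorxx mulr0.
Qed.

(** The three-term Pluecker relation. *)
Definition pluecker_rel (A : pzRingType) (X : E n -> E n -> A) i j k l : A :=
  X i j * X k l - X i k * X j l + X i l * X j k.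

End Alternating.

Section Grassmannian.
Variables (K : fieldType) (n : nat).
Implicit Types (x : pluecker_space K n) (u v : 'rV[K]_(2 * n)).

Lemma plueckerE u v k :
  pluecker u v 0 k = minor (u 0) (v 0) (fst2 (enum_val k)) (snd2 (enum_val k)).
Proof. by rewrite mxE. Qed.

Lemma minor_free u v i j : minor (u 0) (v 0) i j != 0 -> free [:: u; v].
Proof.
move=> ij; rewrite free_cons span_seq1 seq1_free; apply/andP; split.
  apply: contra ij => /vlineP[a ->]; rewrite /minor !mxE.
  by apply/eqP; ring.
by apply: contraNneq ij => ->; rewrite /minor !mxE !mulr0 subrr.
Qed.

Lemma pluecker_neq0 u v : pluecker u v != 0 ->
  exists i j, minor (u 0) (v 0) i j != 0.
Proof.
move=> nz; apply: contrapT => no; case/eqP: nz; apply/rowP => k.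
rewrite plueckerE mxE; apply/eqP/negPn/negP => H; apply: no.
by exists (fst2 (enum_val k)), (snd2 (enum_val k)).
Qed.

Lemma line_neq0 x (w : 'rV[K]_#|{: pair2 n}|) : val x = <[w]>%VS -> w != 0.
Proof.
move=> xw; have /eqP := valP x; rewrite /= xw dim_vline.
by case: (w != 0).
Qed.

(** The dimension and basis conditions on a spanning pair are automatic, since
    the Pluecker vector of a line is nonzero. *)
Lemma GrP x : Gr K n x <-> exists u v, val x = <[pluecker u v]>%VS.
Proof.
split=> [[W [u [v [_ _ xuv]]]]|[u [v xuv]]]; first by exists u, v.
have [i [j ij]] := pluecker_neq0 (line_neq0 xuv).
have fr := minor_free ij.
exists <<[:: u; v]>>%VS, u, v; split=> //; first by rewrite (eqnP fr).
by rewrite basisEfree fr subvv (eqnP fr) /=.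
Qed.

Lemma Gr_config x : Gr K n x -> exists (u v : E n -> K) (a : K),
  [/\ a != 0, exists i j, minor u v i j != 0 &
      forall k, hcoord x k = a * minor u v (fst2 (enum_val k)) (snd2 (enum_val k))].
Proof.
move=> /GrP[u [v xuv]]; have [a a0 Ha] := hcoord_line xuv.
exists (u 0), (v 0), a; split=> //; first exact: pluecker_neq0 (line_neq0 xuv).
by move=> k; rewrite Ha plueckerE.
Qed.

Lemma Gr_point (u v : E n -> K) i j : minor u v i j != 0 ->
  exists x, Gr K n x /\ exists2 a, a != 0 &
    forall k, hcoord x k = a * minor u v (fst2 (enum_val k)) (snd2 (enum_val k)).
Proof.
pose ru : 'rV[K]_(2 * n) := \row_k u k; pose rv : 'rV[K]_(2 * n) := \row_k v k.
have mE k l : minor (ru 0) (rv 0) k l = minor u v k l by rewrite /minor !mxE.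
move=> ij; have nz : pluecker ru rv != 0.
  wlog lt : i j ij / (i < j)%N.
    move=> W; have := minor_neq ij.
    rewrite -(inj_eq val_inj) /= neq_ltn => /orP[] lt; first exact: W lt.
    by apply: W lt; rewrite minor_eq0C.
  pose p : pair2 n := exist _ (i, j) lt.
  apply: contraNneq ij => /rowP/(_ (enum_rank p)).
  by rewrite plueckerE enum_rankK mE mxE => ->.
have [x xw] := line_point nz.
exists x; split; first by apply/GrP; exists ru, rv.
by have [a a0 Ha] := hcoord_line xw; exists a => // k; rewrite Ha plueckerE mE.
Qed.

(** The Grassmannian is cut out by the three-term relations: if x_ij is nonzero,
    the rows i and j of the alternating matrix of coordinates span a plane whose
    coordinates are x_ij times those of x. *)
Lemma Gr_pluecker x : Gr K n x <->
  forall i j k l, pluecker_rel (alt (pcoord x)) i j k l = 0.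
Proof.
split=> [/Gr_config[u [v [a [_ _ Ha]]]] i j k l|rel].
  have -> : pcoord x = fun p => a * minor u v (fst2 p) (snd2 p).
    by apply/funext => p; rewrite /pcoord Ha enum_rankK.
  by rewrite /pluecker_rel !alt_minor /minor; ring.
have [k0 k00] : exists k, hcoord x k != 0.
  apply: contrapT => no; case/eqP: (vpick_neq0 x); apply/rowP => k.
  by rewrite mxE; apply/eqP/negPn/negP => ?; apply: no; exists k.
pose X := alt (pcoord x); pose i := fst2 (enum_val k0); pose j := snd2 (enum_val k0).
have Xij : X i j = hcoord x k0 by rewrite /X alt_pair /pcoord enum_valK.
pose u : 'rV[K]_(2 * n) := \row_k X i k; pose v : 'rV[K]_(2 * n) := \row_k X j k.
apply/GrP; exists u, v; rewrite line_vpick.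
suff -> : pluecker u v = X i j *: vpick (val x).
  by apply/esym/eqP; rewrite Xij eqEdim !dim_vline scaler_eq0 (negPf k00) /=
    vpick_neq0 andbT -memvE memvZ ?memv_line.
apply/rowP => k; rewrite plueckerE [RHS]mxE.
have -> : vpick (val x) 0 k = X (fst2 (enum_val k)) (snd2 (enum_val k)).
  by rewrite /X alt_pair /pcoord enum_valK.
have := rel i j (fst2 (enum_val k)) (snd2 (enum_val k)).
rewrite /pluecker_rel -/X /minor !mxE => /eqP H.
by apply/eqP; rewrite -subr_eq0 -oppr_eq0 -(eqP H); apply/eqP; ring.
Qed.

Lemma eq_set2_image (P Q : pred (pair2 n)) : P =1 Q ->
  [set set2 p | p : pair2 n & P p]%SET = [set set2 p | p : pair2 n & Q p]%SET.
Proof. by move=> /funext ->. Qed.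

Section Config.
Variables (x : pluecker_space K n) (u v : E n -> K) (a : K).
Hypothesis a0 : a != 0.
Hypothesis Ha : forall k,
  hcoord x k = a * minor u v (fst2 (enum_val k)) (snd2 (enum_val k)).

Lemma pcoord_config p : pcoord x p = a * minor u v (fst2 p) (snd2 p).
Proof. by rewrite /pcoord Ha enum_rankK. Qed.

Lemma hyperplane_config : hyperplane K n x <-> sform u v = 0.
Proof.
rewrite /hyperplane /=; under eq_bigr do rewrite pcoord_config.
rewrite -mulr_sumr sform_pairs; split=> [/eqP|->]; last by rewrite mulr0.
by rewrite mulf_eq0 (negPf a0) => /eqP.
Qed.

Lemma bases_config :
  [set set2 p | p : pair2 n & pcoord x p != 0]%SET = minor_pairs u v.
Proof.
apply: eq_set2_image => p.
by rewrite pcoord_config mulf_eq0 negb_or a0.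
Qed.
End Config.

Lemma sympl_basesE x : sympl_bases x =
  [set X in [set set2 p | p : pair2 n & pcoord x p != 0]%SET | admissible X]%SET.
Proof.
apply/setP => X; rewrite !inE; apply/imsetP/andP => [[p]|[/imsetP[p]]].
  by rewrite inE => /andP[adm nz] ->; split=> //; apply: imset_f; rewrite inE.
by rewrite inE => nz -> adm; exists p; rewrite // inE adm.
Qed.

Lemma Gr_closed : closed (Gr K n).
Proof.
apply/closedP.
pose X := alt (fun p : pair2 n => ('X_(enum_rank p) : {mpoly K[#|{: pair2 n}|]})).
have altX x i j : (X i j).@[hcoord x] = alt (pcoord x) i j.
  rewrite /X (alt_morph (meval (hcoord x))); congr alt; apply/funext => p /=.
  by rewrite mevalXU.
have hX i j : X i j \is 1.-homog.
  rewrite /X /alt; case: insubP => [p _ _|_]; first by rewrite dhomogX /= mdeg1.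
  by case: insubP => [p _ _|_]; rewrite ?dhomogN ?dhomog0 // dhomogX /= mdeg1.
exists [set f | exists i j k l, f = pluecker_rel X i j k l].
  move=> _ [i [j [k [l ->]]]]; exists 2%N.
  have hXX a b c d : X a b * X c d \is 2.-homog by apply: (dhomogM (hX _ _) (hX _ _)).
  by rewrite /pluecker_rel !dhomogD // dhomogN.
have relE x i j k l : (pluecker_rel X i j k l).@[hcoord x]
    = pluecker_rel (alt (pcoord x)) i j k l.
  by rewrite /pluecker_rel mevalD mevalB !mevalM !altX.
apply/seteqP; split=> x.
  by move=> /Gr_pluecker H _ [i [j [k [l ->]]]]; rewrite relE.
by move=> H; apply/Gr_pluecker => i j k l; rewrite -relE; apply: H; exists i, j, k, l.
Qed.

Lemma closed_vanishing (f : {mpoly K[#|{: pair2 n}|]}) : homogeneous f ->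
  closed [set x : pluecker_space K n | f.@[hcoord x] = 0].
Proof.
move=> hf; apply/closedP; exists [set f]; first by move=> _ ->.
by apply/seteqP; split=> x /=; [move=> ? _ -> | apply].
Qed.

Lemma hyperplane_closed : closed (hyperplane K n).
Proof.
pose f : {mpoly K[#|{: pair2 n}|]} :=
  \sum_(p : pair2 n | snd2 p == star (fst2 p)) 'X_(enum_rank p).
have -> : hyperplane K n = [set x : pluecker_space K n | f.@[hcoord x] = 0].
  have fE (x : pluecker_space K n) : f.@[hcoord x] =
      \sum_(p : pair2 n | snd2 p == star (fst2 p)) pcoord x p.
    by rewrite /f raddf_sum /=; apply: eq_bigr => p _; rewrite mevalXU.
  by apply/seteqP; split=> x; rewrite /hyperplane /= fE.
apply: closed_vanishing; exists 1%N; apply: rpred_sum => p _.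
by rewrite dhomogX /= mdeg1.
Qed.

(** Prescribing some coordinates to be nonzero and some to vanish defines a
    locally closed subset of SpG. *)
Lemma locally_closed_support (P Z : pred (pair2 n)) :
  locally_closed [set x : pluecker_space K n | SpG K n x /\
    forall p, (P p -> pcoord x p != 0) /\ (Z p -> pcoord x p = 0)].
Proof.
pose f : {mpoly K[#|{: pair2 n}|]} := \prod_(p | P p) 'X_(enum_rank p).
have hf : homogeneous f.
  exists (\sum_(p | P p) 1)%N; rewrite /f.
  elim/big_rec2: _ => [|p y z _ hz]; first exact: dhomog1.
  by apply: dhomogM => //; rewrite dhomogX /= mdeg1.
exists [set x | f.@[hcoord x] != 0].
exists (SpG K n `&` \bigcap_(p in [set p | Z p])
  [set x : pluecker_space K n |
    ('X_(enum_rank p) : {mpoly K[#|{: pair2 n}|]}).@[hcoord x] = 0]).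
split.
- exact: open_nonzero.
- apply: closedI; first exact: closedI Gr_closed hyperplane_closed.
  apply: closed_bigI => p _; apply: closed_vanishing; exists 1%N.
  by rewrite dhomogX /= mdeg1.
have fE x : (f.@[hcoord x] != 0) = [forall p, P p ==> (pcoord x p != 0)].
  rewrite /f rmorph_prod /=; under eq_bigr do rewrite mevalXU.
  by apply/prodf_neq0/forall_inP => H p Pp; apply: H.
apply/seteqP; split=> x /=.
  move=> [Sx H]; split.
    by rewrite fE; apply/forall_inP => p; have [h _] := H p.
  by split=> // p /= Zp; rewrite mevalXU; have [_ h] := H p; apply: h.
rewrite fE => -[/forall_inP H1 [Sx H2]]; split=> // p; split; first exact: H1.
by move=> Zp; have := H2 p Zp; rewrite /= mevalXU.
Qed.

Lemma mem_coord_bases (x : pluecker_space K n) (p : pair2 n) :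
  (set2 p \in [set set2 p | p : pair2 n & pcoord x p != 0]%SET)
  = (pcoord x p != 0).
Proof.
apply/imsetP/idP => [[q]|nz]; last by exists p; rewrite ?inE.
rewrite inE => nz /set2_inj[] [E1 E2].
  suff -> : p = q by [].
  by apply/val_inj; rewrite [LHS]surjective_pairing [RHS]surjective_pairing;
    congr pair.
by have := valP p; have := valP q; rewrite /= -/(fst2 p) -/(snd2 p) E1 E2 =>
  /ltnW; rewrite leqNgt => /negP.
Qed.

Lemma thin_SpG_locally_closed (N : BC_matroid n 2) :
  locally_closed (thin_SpG K N).
Proof.
have admN (X : {set E n}) : X \in BC_bases N ->
    (exists2 p : pair2 n, X = set2 p & admissible X).
  have /and3P[_ /forall_inP H _] := BC_basesP N.
  move=> XN; have /andP[adm c2] := H _ XN.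
  have [i [j [ij EX]]] := elimT (cards2P X) c2.
  wlog lt : i j ij EX / (i < j)%N.
    move=> W; move: (ij); rewrite -(inj_eq val_inj) /= neq_ltn => /orP[] lt.
      exact: W lt.
    by apply: W lt; rewrite 1?eq_sym // EX set2C.
  by exists (exist _ (i, j) lt).
have -> : thin_SpG K N = [set x : pluecker_space K n | SpG K n x /\ forall p,
   (set2 p \in BC_bases N -> pcoord x p != 0) /\
   (admissible (set2 p) && (set2 p \notin BC_bases N) -> pcoord x p = 0)].
  apply/seteqP; split=> x /= -[Sx H]; split=> //.
    move=> p; rewrite -H sympl_basesE inE mem_coord_bases.
    by split=> [/andP[]//|/andP[->]]; rewrite andbT negbK => /eqP.
  apply/setP => X; rewrite sympl_basesE inE.
  apply/andP/idP => [[/imsetP[p]]|XN].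
    rewrite inE => nz -> adm; apply: contraNT nz => pN.
    by have [_ h] := H p; rewrite h // adm.
  have [p EX adm] := admN _ XN; split=> //.
  by rewrite EX mem_coord_bases; have [h _] := H p; apply: h; rewrite -EX.
exact: (locally_closed_support (fun p => set2 p \in BC_bases N)
  (fun p => admissible (set2 p) && (set2 p \notin BC_bases N))).
Qed.

Lemma thin_cell_locally_closed (M : matroid (E n)) :
  locally_closed (thin_cell K M `&` hyperplane K n).
Proof.
(* A point of the cell shows that the bases of M are pairs; without points the
   set is empty. *)
have [[x0 [_ H0]]|no] := pselect (exists x, thin_cell K M x); last first.
  exists set0, set0; split; [exact: open0|exact: closed0|].
  by apply/seteqP; split=> x //= -[Mx _]; case: no; exists x.
have -> : thin_cell K M `&` hyperplane K n
    = [set x : pluecker_space K n | SpG K n x /\ forall p,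
   (set2 p \in bases M -> pcoord x p != 0) /\
   (set2 p \notin bases M -> pcoord x p = 0)].
  apply/seteqP; split=> x /=.
    move=> [[Gx H] Hx]; split=> // p; rewrite -H mem_coord_bases.
    by split=> //; rewrite negbK => /eqP.
  move=> [[Gx Hx] H]; split=> //; split=> //; rewrite -H0.
  apply: eq_set2_image => p; rewrite -(mem_coord_bases x0) H0.
  have [h1 h2] := H p; apply/idP/idP => //.
  by apply: contraNT => /h2 ->.
exact: (locally_closed_support (fun p => set2 p \in bases M)
  (fun p => set2 p \notin bases M)).
Qed.

End Grassmannian.

(** * Irreducible and locally closed sets *)

Section Topology.
Variable T : topologicalType.
Implicit Types A B : set T.

(** A locally closed set is open in its closure, so it meets every dense subset
    of that closure. *)
Lemma locally_closed_dense_meet A B : locally_closed A -> A !=set0 ->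
  closure A = closure B -> A `&` B !=set0.
Proof.
move=> [U [F [oU cF ->]]] [a [Ua Fa]] cAB.
have : closure B a by rewrite -cAB; apply: subset_closure.
move=> /(_ U (open_nbhs_nbhs (conj oU Ua)))[b [Bb Ub]].
exists b; split=> //; split=> //.
have : closure (U `&` F) b by rewrite cAB; apply: subset_closure.
have := closure_subset (@subIsetr _ U F) => /[apply].
by rewrite -(closure_id F).1.
Qed.

Lemma irreducible_finite_cover (I : finType) A (F : I -> set T) :
  irreducible A -> (forall i, closed (F i)) ->
  (forall x, A x -> exists i, F i x) -> exists i, A `<=` F i.
Proof.
move=> [[x0 Ax0] irr] cF cov.
suff H (s : seq I) (G : set T) : closed G ->
    (forall x, A x -> G x \/ exists2 i, i \in s & F i x) ->
    A `<=` G \/ exists i, A `<=` F i.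
  have [|/(_ x0 Ax0)//|//] := H (enum I) set0 closed0.
  by move=> x /cov[i Fx]; right; exists i; rewrite ?mem_enum.
elim: s G => [|i s IHs] G cG HG.
  by left=> x /HG[|[]].
have cov' x : A x -> (G `|` F i) x \/ exists2 j, j \in s & F j x.
  move=> /HG[Gx|[j]]; first by left; left.
  rewrite inE => /orP[/eqP -> Fx|js Fx]; first by left; right.
  by right; exists j.
have [sub|] := IHs _ (closedU cG (cF i)) cov'; last by right.
by have [?|?] := irr _ _ cG (cF i) sub; [left|right; exists i].
Qed.

End Topology.

(** * Irreducibility of the symplectic thin cells *)

Lemma poly_nonroot (K : numFieldType) (p : {poly K}) :
  p != 0 -> exists t, p.[t] != 0.
Proof.
move=> p0; apply: contrapT => no.
pose rs : seq K := [seq i%:R | i <- iota 0 (size p)].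
suff : (size rs < size p)%N by rewrite size_map size_iota ltnn.
apply: max_poly_roots => //.
  apply/allP => t _; apply/negPn/negP => pt; apply: no.
  by exists t.
rewrite map_inj_uniq ?iota_uniq // => i j /eqP.
by rewrite eqr_nat => /eqP.
Qed.

(** Substituting polynomials for the variables commutes with evaluation. *)
Lemma horner_mmap (K : fieldType) m (f : {mpoly K[m]}) (h : 'I_m -> {poly K}) t :
  (mmap polyC h f).[t] = f.@[fun k => (h k).[t]].
Proof.
rewrite /mmap horner_sum mevalE; apply: eq_bigr => mm _.
rewrite hornerM hornerC /mmap1 horner_prod; congr (_ * _).
by apply: eq_bigr => i _; rewrite horner_exp.
Qed.

Section Main.
Variables (K : numFieldType) (n : nat).

Lemma SpG_config (x : pluecker_space K n) : SpG K n x ->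
  exists (u v : E n -> K) (a : K), [/\ a != 0, sform u v = 0,
    exists i j, minor u v i j != 0,
    forall k, hcoord x k = a * minor u v (fst2 (enum_val k)) (snd2 (enum_val k)) &
    sympl_bases x = [set X in minor_pairs u v | admissible X]%SET].
Proof.
move=> [/Gr_config[u [v [a [a0 nz Ha]]]] Hx]; exists u, v, a; split=> //.
  exact/(hyperplane_config a0 Ha).
by rewrite sympl_basesE (bases_config a0 Ha).
Qed.

(** If SpG_N were covered by two closed sets, neither containing it, some
    forms f and g, vanishing on one each, would be nonzero at points x and y of SpG_N.  Along the
    curve from x to y, f, g and the minors of the bases are nonzero polynomials
    in t, so at some t none vanishes, which gives a point of SpG_N outside both
    closed sets. *)
Lemma thin_SpG_irreducible (N : BC_matroid n 2) :
  representable K n N -> irreducible (thin_SpG K N).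
Proof.
move=> [x0 Sx0 Nx0]; split; first by exists x0.
move=> F1 F2 /closedP[S1 h1 ->] /closedP[S2 h2 ->] sub.
apply: contrapT => /not_orP[].
move=> /existsNP[x /not_implyP[[Sx Nx] /existsNP[f /not_implyP[S1f /eqP fx]]]].
move=> /existsNP[y /not_implyP[[Sy Ny] /existsNP[g /not_implyP[S2g /eqP gy]]]].
have [df hf] := h1 _ S1f; have [dg hg] := h2 _ S2g.
have [u [v [a [a0 Q0 nz Ha Bx]]]] := SpG_config Sx.
have [u' [v' [a' [a0' Q0' _ Ha' By]]]] := SpG_config Sy.
have pat : forall i j, j != star i ->
    (minor u v i j == 0) = (minor u' v' i j == 0).
  by apply: admissible_pairs_pattern; rewrite -Bx -By Nx Ny.
have [U [V [b [b' [[b0 b0'] H0 H1 QUV zUV]]]]] := joining_curve Q0 Q0' nz pat.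
have minor0 i j : (minor U V i j).[0] = b ^+ 2 * minor u v i j.
  rewrite horner_minor /minor; have [-> ->] := H0 i; have [-> ->] := H0 j.
  by ring.
have minor1 i j : (minor U V i j).[1] = b' ^+ 2 * minor u' v' i j.
  rewrite horner_minor /minor; have [-> ->] := H1 i; have [-> ->] := H1 j.
  by ring.
pose PL (k : 'I_#|{: pair2 n}|) := minor U V (fst2 (enum_val k)) (snd2 (enum_val k)).
pose Pf := mmap polyC PL f; pose Pg := mmap polyC PL g.
have Pf0 : Pf != 0.
  apply: contraNneq fx => Pf0; have : Pf.[0] = 0 by rewrite Pf0 horner0.
  rewrite horner_mmap; rewrite (meval_eq _ (fun k => minor0 _ _)).
  rewrite (meval_scale _ _ hf) => /eqP.
  rewrite mulf_eq0 !expf_eq0 (negPf b0) !andbF /= => /eqP E0.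
  rewrite (meval_eq _ Ha) (meval_scale _ _ hf).
  by rewrite E0 mulr0.
have Pg0 : Pg != 0.
  apply: contraNneq gy => Pg0; have : Pg.[1] = 0 by rewrite Pg0 horner0.
  rewrite horner_mmap; rewrite (meval_eq _ (fun k => minor1 _ _)).
  rewrite (meval_scale _ _ hg) => /eqP.
  rewrite mulf_eq0 !expf_eq0 (negPf b0') !andbF /= => /eqP E0.
  rewrite (meval_eq _ Ha') (meval_scale _ _ hg).
  by rewrite E0 mulr0.
pose G := \prod_(p : E n * E n | minor u v p.1 p.2 != 0) minor U V p.1 p.2.
have G0 : G != 0.
  apply/prodf_neq0 => p mp; apply: contraNneq mp => m0.
  have := minor0 p.1 p.2; rewrite m0 horner0 => /esym/eqP.
  by rewrite mulf_eq0 expf_eq0 (negPf b0) andbF.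
have [t] := @poly_nonroot K (Pf * Pg * G) (mulf_neq0 (mulf_neq0 Pf0 Pg0) G0).
rewrite !hornerM !mulf_eq0 !negb_or => /andP[/andP[Pft Pgt] Gt].
pose ut i := (U i).[t]; pose vt i := (V i).[t].
have mt i j : minor ut vt i j = (minor U V i j).[t] by rewrite horner_minor.
have mtn i j : minor u v i j != 0 -> minor ut vt i j != 0.
  move=> ij; rewrite mt; apply: contraNneq Gt => m0.
  by rewrite /G (bigD1 (i, j)) //= hornerM m0 mul0r.
have [i [j ij]] := nz.
have [z [Gz [c c0 Hc]]] := Gr_point (mtn _ _ ij).
have Az : thin_SpG K N z.
  split; first split=> //.
    apply/(hyperplane_config c0 Hc).
    by rewrite -horner_sform QUV horner0.
  rewrite sympl_basesE (bases_config c0 Hc) -Nx Bx.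
  apply: admissible_pairs_eq => k l lk; apply/idP/idP.
    by apply: contraLR => /mtn.
  by move=> /eqP m0; rewrite mt zUV // horner0.
have zE (h : {mpoly K[#|{: pair2 n}|]}) d : h \is d.-homog -> h.@[hcoord z] = 0 ->
    (mmap polyC PL h).[t] = 0.
  move=> hh; rewrite (meval_eq _ Hc) (meval_scale _ _ hh) => /eqP.
  rewrite mulf_eq0 expf_eq0 (negPf c0) andbF /= => /eqP E0.
  by rewrite horner_mmap -[RHS]E0; apply: meval_eq => k; rewrite mt.
have [Fz|Fz] := sub _ Az.
  by move: Pft; rewrite (zE _ _ hf (Fz _ S1f)) eqxx.
by move: Pgt; rewrite (zE _ _ hg (Fz _ S2g)) eqxx.
Qed.

Lemma matroid_eq (T : finType) (M M' : matroid T) : bases M = bases M' -> M = M'.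
Proof. by move=> H; apply: val_inj. Qed.

Lemma BC_matroid_eq k (N N' : BC_matroid n k) : BC_bases N = BC_bases N' -> N = N'.
Proof. by move=> H; apply: val_inj. Qed.

Lemma Gr_matroid (x : pluecker_space K n) : Gr K n x ->
  exists M, thin_cell K M x.
Proof.
move=> Gx; have [u [v [a [a0 nz Ha]]]] := Gr_config Gx.
exists (Matroid (minor_pairs_matroid nz)); split=> //=.
exact: bases_config a0 Ha.
Qed.

Lemma SpG_BC_matroid (x : pluecker_space K n) : SpG K n x ->
  exists N : BC_matroid n 2, sympl_bases x = BC_bases N.
Proof.
move=> /SpG_config[u [v [a [_ Q0 nz _ ->]]]].
by exists (BCMatroid (minor_pairs_BC Q0 nz)).
Qed.

Lemma thin_SpG_decomposes (N : BC_matroid n 2) :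
  exists D, decomposes K N D.
Proof.
exists [set M | exists x, thin_SpG K N x /\ thin_cell K M x]; split.
  move=> M [x [_ [_ EM]]] X; rewrite -EM => /imsetP[p _ ->]; rewrite /set2 cards2.
  by have -> : fst2 p != snd2 p by rewrite -(inj_eq val_inj) /= neq_ltn (valP p).
split.
  apply/seteqP; split=> x.
    move=> Nx; have [[Gx Hx] _] := Nx.
    by have [M Mx] := Gr_matroid Gx; exists M => //; exists x.
  move=> [M [y [[_ Ny] [_ My]]] [[Gx Mx] Hx]]; split=> //.
  by rewrite -Ny !sympl_basesE Mx My.
move=> M M' _ _ [x [[[_ Mx] _] [[_ Mx'] _]]].
by apply: matroid_eq; rewrite -Mx.
Qed.

Lemma SpG_disjoint_union :
  is_disjoint_union (SpG K n) (representable K n) (fun N => thin_SpG K N).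
Proof.
split.
  apply/seteqP; split=> x; last by move=> [N _ []].
  move=> Sx; have [N Nx] := SpG_BC_matroid Sx.
  by exists N => //; exists x.
by move=> N N' _ _ [x [[_ Nx] [_ Nx']]]; apply: BC_matroid_eq; rewrite -Nx.
Qed.

Lemma unique_dense_cell (N : BC_matroid n 2) D : representable K n N ->
  decomposes K N D ->
  exists! M, D M /\ closure (thin_SpG K N) =
    closure (thin_cell K M `&` hyperplane K n).
Proof.
move=> rN [_ [UD tD]].
have irr := thin_SpG_irreducible rN.
(* Intersecting with the condition D M makes the matroids outside D contribute
   the empty set. *)
pose F (M : matroid (E n)) :=
  closure (thin_cell K M `&` hyperplane K n `&` [set _ | D M]).
have [||M NM] := irreducible_finite_cover irr (F := F).
- by move=> M; apply: closed_closure.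
- move=> x; rewrite {1}UD => -[M DM Mx]; exists M.
  exact: subset_closure.
have [[x0 Nx0] _] := irr.
have DM : D M.
  apply: contrapT => nD; have := NM _ Nx0; rewrite /F.
  have -> : [set _ : pluecker_space K n | D M] = set0.
    by apply/seteqP; split.
  by rewrite setI0 closure0.
have cM : closure (thin_SpG K N) = closure (thin_cell K M `&` hyperplane K n).
  apply/seteqP; split.
    rewrite [X in _ `<=` X]((closure_id _).1 (@closed_closure _ _)).
    apply: closure_subset; apply: subset_trans NM _.
    by apply: closure_subset; apply: subIsetl.
  by apply: closure_subset => x Mx; rewrite UD; exists M.
exists M; split=> // M' [DM' cM'].
apply: tD => //; apply: locally_closed_dense_meet.
- exact: thin_cell_locally_closed.
- apply: contrapT => /nonemptyPn E0.
  have : closure (thin_SpG K N) x0 by apply: subset_closure.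
  by rewrite cM E0 closure0.
by rewrite -cM -cM'.
Qed.

End Main.

Theorem theorem4p8 (R : realType) (n : nat) (hn : (2 <= n)%N) :
  ((forall N : BC_matroid n 2, representable R[i] n N ->
      exists D : set (matroid (E n)), decomposes R[i] N D) /\
   is_disjoint_union (SpG R[i] n) (representable R[i] n)
     (fun N => thin_SpG R[i] N) /\
   (forall N : BC_matroid n 2, representable R[i] n N ->
      locally_closed (thin_SpG R[i] N))) /\
  (forall N : BC_matroid n 2, representable R[i] n N ->
     (forall D : set (matroid (E n)), decomposes R[i] N D ->
        exists! M : matroid (E n), D M /\
          closure (thin_SpG R[i] N) =
          closure (thin_cell R[i] M `&` hyperplane R[i] n)) /\
     irreducible (thin_SpG R[i] N)).
Proof.
split; first split; [|split|].
- by move=> N _; apply: thin_SpG_decomposes.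
- exact: SpG_disjoint_union.
- by move=> N _; apply: thin_SpG_locally_closed.
move=> N rN; split; last exact: thin_SpG_irreducible.
by move=> D; apply: unique_dense_cell.
Qed.
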